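(* Assume that $\mathcal{I}$ is an ideal on $\mathbb{N}$ with the Baire property. Then the set $$\{f\in C(P_{\mathcal{I}}):\operatorname{rng}(f)\text{ is an interval}\}\cup\{0\}$$ contains a linear subspace isometric to $C(\beta\mathbb{N}\setminus\mathbb{N})$.
   Context: An ideal on $\mathbb{N}$ is a family of subsets of $\mathbb{N}$ closed under finite unions and subsets, not containing $\mathbb{N}$ and containing all singletons. Identifying subsets of $\mathbb{N}$ with their characteristic functions, $\mathcal{I}$ is a subset of the Cantor space $\{0,1\}^{\mathbb{N}}$; it has the Baire property if it does as a subset of $\{0,1\}^{\mathbb{N}}$. $\mathcal{I}^*=\{\mathbb{N}\setminus A:A\in\mathcal{I}\}$ is the dual filter. $\beta\mathbb{N}\setminus\mathbb{N}$ is the remainder of the Čech–Stone compactification of the discrete space $\mathbb{N}$, i.e. the compact space of non-principal ultrafilters on $\mathbb{N}$. $P_{\mathcal{I}}$ is the closed subspace of $\beta\mathbb{N}\setminus\mathbb{N}$ consisting of those ultrafilters that contain $\mathcal{I}^*$. For compact $K$, $C(K)$ is the Banach space of real-valued continuous functions on $K$ with the supremum norm, and $\operatorname{rng}(f)=f(K)$. *)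

(* Defs.v *)
From HB Require Import structures.
From mathcomp Require Import all_boot all_order all_algebra.
From mathcomp Require Import all_classical all_reals all_analysis.

Set Implicit Arguments.
Unset Strict Implicit.
Unset Printing Implicit Defensive.

Import Order.TTheory GRing.Theory Num.Theory.
Import numFieldNormedType.Exports.

Local Open Scope classical_set_scope.
Local Open Scope ring_scope.

Definition nowhere_dense (T : topologicalType) (A : set T) : Prop :=
  interior (closure A) = set0.

Definition meager (T : topologicalType) (A : set T) : Prop :=
  exists2 F : nat -> set T,
    (forall n, nowhere_dense (F n)) & A = \bigcup_n F n.

Definition baire_property (T : topologicalType) (A : set T) : Prop :=
  exists2 U : set T, open U & meager (A `+` U).

Definition is_ideal (I : set (set nat)) : Prop :=
  [/\ forall A B, I A -> I B -> I (A `|` B),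
      forall A B, A `<=` B -> I B -> I A,
      ~ I setT &
      forall n, I [set n]].

Definition char_fun (A : set nat) : cantor_space := fun n => `[< A n >].

Definition ideal_baire (I : set (set nat)) : Prop :=
  baire_property (char_fun @` I).

Definition dual_filter (I : set (set nat)) : set_system nat :=
  [set ~` A | A in I].

(* The Stone-Cech compactification of the discrete space nat, realized as the
   space of all ultrafilters on nat with the Stone topology. *)

Definition betaN : Type := {U : set_system nat | UltraFilter U}.

HB.instance Definition _ := gen_eqMixin betaN.
HB.instance Definition _ := gen_choiceMixin betaN.

Definition stone_basic (A : set nat) : set betaN := [set U | sval U A].

Lemma stone_basic_cover : \bigcup_(A in [set: set nat]) stone_basic A = setT.
Proof.
apply/seteqP; split => // -[U UU] _; exists setT => //=.
exact: filterT.
Qed.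

Lemma stone_basic_join (A B : set nat) (U : betaN) :
  [set: set nat] A -> [set: set nat] B -> stone_basic A U -> stone_basic B U ->
  exists C, [/\ [set: set nat] C, stone_basic C U &
                stone_basic C `<=` stone_basic A `&` stone_basic B].
Proof.
case: U => U UU _ _ /= UA UB; exists (A `&` B); split=> //.
  exact: filterI.
move=> [V VV] VAB; split; apply: filterS VAB => x []//.
Qed.

HB.instance Definition _ :=
  isBaseTopological.Build betaN stone_basic_cover stone_basic_join.

Definition remainder : set betaN :=
  [set U | forall n, sval U <> principal_filter n].

Definition Nstar : Type := set_type remainder.

HB.instance Definition _ := Topological.on Nstar.

Definition P_ideal_set (I : set (set nat)) : set Nstar :=
  [set U | dual_filter I `<=` sval (set_val U)].

Definition P_ideal (I : set (set nat)) : Type := set_type (P_ideal_set I).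

HB.instance Definition _ I := Topological.on (P_ideal I).

HB.mixin Record isCompactSpace T & Topological T := {
  compactT : compact [set: T]
}.

#[short(type = "compactSpaceType")]
HB.structure Definition CompactSpace := {T of Topological T & isCompactSpace T}.

Lemma open_stone_basic A : open (stone_basic A).
Proof.
exists [set A] => //.
by rewrite bigcup_set1.
Qed.

Lemma closed_stone_basic A : closed (stone_basic A).
Proof.
rewrite (_ : stone_basic A = ~` stone_basic (~` A)).
  exact/open_closedC/open_stone_basic.
apply/seteqP; split => -[U UU] /=.
  move=> UA UnA; have : U set0 by rewrite -(setICr A); exact: filterI.
  exact: filter_not_empty.
by case: (in_ultra_setVsetC A UU).
Qed.

Lemma betaN_compact : compact [set: betaN].
Proof.
rewrite compact_ultra => F UF _.
pose U : set_system nat := [set A | F (stone_basic A)].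
have PU : ProperFilter U.
  apply: Build_ProperFilter_ex.
    move=> A UA; have [[V VV] VA] := @filter_ex _ F _ _ UA.
    exact: (@filter_ex _ V).
  split=> [|A B UA UB|A B AB UA].
  - by apply: (@filterS _ F _ setT) filterT => -[V VV] _; exact: filterT.
  - apply: (@filterS _ F _ _ _ _ (@filterI _ F _ _ _ UA UB)) => -[V VV] [VA VB].
    exact: filterI.
  - by apply: (@filterS _ F _ _ _ _ UA) => -[V VV] VA; exact: filterS VA.
have UU : UltraFilter U.
  split=> // G PG UG; apply/seteqP; split => // A GA.
  have [//|FA] := in_ultra_setVsetC (stone_basic A) UF.
  have UnA : U (~` A).
    apply: (@filterS _ F _ _ _ _ FA) => -[V VV] /= VnA.
    by case: (in_ultra_setVsetC A VV).
  have : G set0 by rewrite -(setICr A); apply: filterI => //; exact: UG.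
  by move/filter_not_empty.
exists (exist _ U UU); split => //= W.
rewrite nbhsE => -[Y [[D _ <-] [A DA UA]] YW].
apply: (@filterS _ F _ _ _ _ UA) => V VA; apply: YW.
by exists A.
Qed.

HB.instance Definition _ := isCompactSpace.Build betaN betaN_compact.

Lemma compact_set_type (T : topologicalType) (A : set T) :
  compact A -> compact [set: set_type A].
Proof.
move=> cA F PF _.
pose G : set_system T := fmap set_val F.
have PG : ProperFilter G by exact: fmap_proper_filter.
have GA : G A.
  apply: (@filterS _ F _ setT) filterT => x _; exact: set_valP.
have [x [Ax Gx]] := cA G PG GA.
exists (SigSub (mem_set Ax)); split=> // B C FB.
rewrite nbhsE => -[_ [[Y oY <-] /= Yx] YC].
have GB : G (set_val @` B).
  by apply: (@filterS _ F _ _ _ _ FB) => y By; exists y.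
have [_ [[y By <-] Yy]] := Gx _ _ GB (open_nbhs_nbhs (conj oY Yx)).
by exists y; split=> //; exact: YC.
Qed.

Lemma closed_compact_set_type (T : compactSpaceType) (A : set T) :
  closed A -> compact [set: set_type A].
Proof.
by move=> cA; apply: compact_set_type; apply: subclosed_compact compactT _.
Qed.

Lemma remainder_closed : closed remainder.
Proof.
rewrite (_ : remainder = \bigcap_n ~` stone_basic [set n]).
  by apply: closed_bigI => n _; apply/open_closedC/open_stone_basic.
apply/seteqP; split => -[U UU] /= H n => [_|] /= Un; last first.
  by apply: (H n) => //=; rewrite Un; exact/principal_filterP.
apply: (H n).
apply: (@max_filter _ _ (principal_filter_ultra n)) => A.
move=> /principal_filterP An; apply: (@filterS _ U _ _ _ _ Un).
by move=> _ ->.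
Qed.

Lemma P_ideal_set_closed I : closed (P_ideal_set I).
Proof.
rewrite (_ : P_ideal_set I =
    set_val @^-1` (\bigcap_(A in dual_filter I) stone_basic A)).
  apply: preimage_closed; last first.
    by apply: closed_bigI => A _; exact: closed_stone_basic.
  by move=> U _; exact: initial_continuous.
by [].
Qed.

HB.instance Definition _ :=
  isCompactSpace.Build Nstar (closed_compact_set_type remainder_closed).

HB.instance Definition _ I :=
  isCompactSpace.Build (P_ideal I)
    (closed_compact_set_type (P_ideal_set_closed (I := I))).

(* C(K) with the supremum norm.  This is an alias of [continuousType] because
   the latter already carries an instance of another topology. *)

Definition Cspace (R : realType) (K : compactSpaceType) : Type :=
  continuousType K R.

Section Cspace_theory.
Variables (R : realType) (K : compactSpaceType).
Implicit Types f g h : Cspace R K.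

HB.instance Definition _ := Choice.on (Cspace R K).

Definition Cspace_fun (f : Cspace R K) : K -> R := f.

Lemma Cspace_continuous f : continuous (Cspace_fun f).
Proof. exact: cts_fun. Qed.

Lemma Cspace_ext f g : Cspace_fun f =1 Cspace_fun g -> f = g.
Proof. by move=> fg; apply/continuousEP. Qed.

Lemma Cspace_add_subproof f g :
  continuous (fun x => Cspace_fun f x + Cspace_fun g x).
Proof. by move=> x; apply: cvgD; exact: Cspace_continuous. Qed.

Lemma Cspace_opp_subproof f : continuous (fun x => - Cspace_fun f x).
Proof. by move=> x; apply: cvgN; exact: Cspace_continuous. Qed.

Lemma Cspace_scale_subproof (a : R) f :
  continuous (fun x => a * Cspace_fun f x).
Proof. by move=> x; apply: cvgMr; exact: Cspace_continuous. Qed.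

Definition Cspace_zero : Cspace R K := mkcts (@cst_continuous K R 0).
Definition Cspace_add f g : Cspace R K := mkcts (@Cspace_add_subproof f g).
Definition Cspace_opp f : Cspace R K := mkcts (@Cspace_opp_subproof f).
Definition Cspace_scale (a : R) f : Cspace R K :=
  mkcts (@Cspace_scale_subproof a f).

Fact Cspace_addA : associative Cspace_add.
Proof. by move=> f g h; apply: Cspace_ext => x; exact: addrA. Qed.

Fact Cspace_addC : commutative Cspace_add.
Proof. by move=> f g; apply: Cspace_ext => x; exact: addrC. Qed.

Fact Cspace_add0 : left_id Cspace_zero Cspace_add.
Proof. by move=> f; apply: Cspace_ext => x; exact: add0r. Qed.

Fact Cspace_addN : left_inverse Cspace_zero Cspace_opp Cspace_add.
Proof. by move=> f; apply: Cspace_ext => x; exact: addNr. Qed.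

HB.instance Definition _ := GRing.isZmodule.Build (Cspace R K)
  Cspace_addA Cspace_addC Cspace_add0 Cspace_addN.

Fact Cspace_scaleA a b f :
  Cspace_scale a (Cspace_scale b f) = Cspace_scale (a * b) f.
Proof. by apply: Cspace_ext => x; exact: mulrA. Qed.

Fact Cspace_scale1 : left_id 1 Cspace_scale.
Proof. by move=> f; apply: Cspace_ext => x; exact: mul1r. Qed.

Fact Cspace_scaleDr : right_distributive Cspace_scale +%R.
Proof. by move=> a f g; apply: Cspace_ext => x; exact: mulrDr. Qed.

Fact Cspace_scaleDl f : {morph Cspace_scale^~ f : a b / a + b}.
Proof. by move=> a b; apply: Cspace_ext => x; exact: mulrDl. Qed.

HB.instance Definition _ := GRing.Zmodule_isLmodule.Build R (Cspace R K)
  Cspace_scaleA Cspace_scale1 Cspace_scaleDr Cspace_scaleDl.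

Definition sup_norm (f : Cspace R K) : R :=
  sup (range (fun x => `|Cspace_fun f x|)).

Lemma sup_norm_ub f x : `|Cspace_fun f x| <= sup_norm f.
Proof.
apply: ub_le_sup; last by exists x.
have cf : compact (range (Cspace_fun f)).
  apply: continuous_compact; last exact: compactT.
  exact/continuous_subspaceT/Cspace_continuous.
have [M [_ HM]] := compact_bounded cf.
exists (M + 1) => _ [y _ <-].
by apply: (HM (M + 1)); [rewrite ltrDl | exists y].
Qed.

Lemma sup_norm_empty f : ~ (exists x : K, True) -> sup_norm f = 0.
Proof.
move=> K0; rewrite -(@sup0 R); congr sup.
by apply/seteqP; split => // y [x _ _]; case: K0; exists x.
Qed.

Lemma sup_norm_ge0 f : 0 <= sup_norm f.
Proof.
have [[x _]|K0] := pselect (exists x : K, True).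
  exact: le_trans (sup_norm_ub f x).
by rewrite sup_norm_empty.
Qed.

Lemma sup_norm_le f (M : R) : 0 <= M ->
  (forall x, `|Cspace_fun f x| <= M) -> sup_norm f <= M.
Proof.
move=> M0 fM; have [[x _]|K0] := pselect (exists x : K, True).
  by apply: ge_sup; [exists `|Cspace_fun f x|, x | move=> _ [y _ <-]].
by rewrite sup_norm_empty.
Qed.

Fact sup_normD f g : sup_norm (f + g) <= sup_norm f + sup_norm g.
Proof.
apply: sup_norm_le => [|x]; first by rewrite addr_ge0 ?sup_norm_ge0.
by apply: (le_trans (ler_normD _ _)); rewrite lerD ?sup_norm_ub.
Qed.

Let sup_normZ_le a f : sup_norm (a *: f) <= `|a| * sup_norm f.
Proof.
apply: sup_norm_le => [|x]; first by rewrite mulr_ge0 ?sup_norm_ge0.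
by rewrite [X in X <= _]normrM ler_wpM2l ?sup_norm_ub.
Qed.

Fact sup_normZ a f : sup_norm (a *: f) = `|a| * sup_norm f.
Proof.
have [->|a0] := eqVneq a 0.
  apply/eqP; rewrite eq_le sup_normZ_le/= normr0 mul0r.
  exact: sup_norm_ge0.
apply/eqP; rewrite eq_le sup_normZ_le/=.
have := sup_normZ_le a^-1 (a *: f).
rewrite scalerA mulVf// scale1r normfV.
by rewrite ler_pdivlMl ?normr_gt0.
Qed.

Fact sup_norm0_eq0 f : sup_norm f = 0 -> f = 0.
Proof.
move=> f0; apply: Cspace_ext => x; apply/normr0_eq0/eqP.
by rewrite eq_le normr_ge0 -f0 sup_norm_ub.
Qed.

HB.instance Definition _ := Lmodule_isNormed.Build R (Cspace R K)
  sup_normD sup_normZ sup_norm0_eq0.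

End Cspace_theory.

Definition rng (R : realType) (K : compactSpaceType) (f : Cspace R K) : set R :=
  range (Cspace_fun f).

(* Singletons are excluded: constant functions are not meant to have an interval
   as range, which is why 0 has to be adjoined separately. *)
Definition proper_interval (R : realType) (A : set R) : Prop :=
  is_interval A /\ exists x y, [/\ A x, A y & x < y].

Definition linear_subspace (R : realType) (E : normedModType R) (V : set E) :=
  V 0 /\ forall (a : R) u v, V u -> V v -> V (a *: u + v).

(* Isometric as normed spaces: through a linear isometry of E onto V. *)
Definition isometric_to (R : realType) (E F : normedModType R) (V : set F) :=
  exists T : {linear E -> F}, (forall x, `|T x| = `|x|) /\ range T = V.

(* Main.v *)
(* By Talagrand's theorem an ideal I with the Baire property admits a
   finite-to-one phi : nat -> nat such that no infinite set has its phi-preimage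
   in I.  Reading phi k + 1 as 2^n + j with j < 2^n gives g k := n, again
   finite-to-one, and a dyadic t k := 2 (2^n + j) / 2^n - 3 in [-1, 1[.  Pushing
   ultrafilters forward along g and taking limits of t define continuous maps
   pi : P_I -> N^* and tau : P_I -> [-1, 1], and (pi, tau) is onto
   N^* x [-1, 1].  Hence f |-> tau * (f o pi) is a linear isometry, and the
   range of the image of f is the whole interval [-|f|, |f|]. *)
Require Import Defs.
From HB Require Import structures.
From mathcomp Require Import all_boot all_order all_algebra.
From mathcomp Require Import all_classical all_reals all_analysis.
From mathcomp Require Import zify ring lra.

Set Implicit Arguments.
Unset Strict Implicit.
Unset Printing Implicit Defensive.

Import Order.TTheory GRing.Theory Num.Theory.
Import numFieldNormedType.Exports.

Local Open Scope classical_set_scope.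
Local Open Scope ring_scope.

(** * Meager sets in the Cantor space, described by finite blocks *)

Definition cylinder (x : cantor_space) (p : nat) : set cantor_space :=
  [set y | forall i, (i < p)%N -> y i = x i].

Lemma nbhs_cylinder x p : nbhs x (cylinder x p).
Proof.
elim: p => [|p IHp]; first by apply: (filterS _ filterT) => y _ i.
have nx : nbhs x [set y : cantor_space | y p = x p].
  have /(_ [set x p])/= := @proj_continuous nat (fun=> bool) p x.
  by apply; rewrite nbhs_principalE; exact/principal_filterP.
apply: (filterS _ (filterI IHp nx)) => y [yx ypx] i /=.
by rewrite ltnS leq_eqVlt => /predU1P[->|/yx].
Qed.

(** The filter generated by the cylinders at [x] converges to [x] coordinatewise, hence in the
    product topology, and so contains every neighbourhood of [x]. *)
Lemma nbhs_has_cylinder x (A : set cantor_space) :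
  nbhs x A -> exists p, cylinder x p `<=` A.
Proof.
pose F := filter_from [set: nat] (cylinder x).
have FF : Filter F.
  apply: filter_from_filter; first by exists 0%N.
  move=> p q _ _; exists (maxn p q) => // y yx.
  by split=> i ip; apply: yx; rewrite leq_max ip ?orbT.
have Fx : F --> x.
  apply/pointwise_cvgP => n B; rewrite nbhs_principalE => /principal_filterP Bx.
  by exists n.+1 => // y /= ->.
by move=> /Fx[p _ pA]; exists p.
Qed.

Definition agree (p q : nat) (x y : cantor_space) : Prop :=
  forall i, (p <= i < q)%N -> x i = y i.

Definition blocks (F : set cantor_space) (p q : nat) (z : cantor_space) :=
  forall y, agree p q y z -> ~ F y.

Lemma nowhere_dense_cylinder (F : set cantor_space) (x : cantor_space) p :
  nowhere_dense F ->
  exists q x', [/\ (p <= q)%N, cylinder x p x' & cylinder x' q `<=` ~` F].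
Proof.
move=> nF; have : ~ cylinder x p `<=` closure F.
  move=> xF; have : interior (closure F) x.
    by apply: filterS xF (nbhs_cylinder x p).
  by rewrite nF.
move=> /existsNP[x' /not_implyP[xx' nx']].
have [q qF] : exists q, cylinder x' q `<=` ~` F.
  apply: nbhs_has_cylinder.
  move/existsNP: nx' => [B /not_implyP[nB BF]].
  by apply: filterS nB => y By Fy; apply: BF; exists y.
exists (maxn p q), x'; split=> //; first exact: leq_maxl.
by move=> y yx'; apply: qF => i iq; apply: yx'; rewrite leq_max iq orbT.
Qed.

(* The finitely many initial segments of length p are handled one after the
   other, so that a single block avoids F after each of them. *)
Lemma nowhere_dense_block (F : set cantor_space) p (z : cantor_space) r :
  (p <= r)%N -> nowhere_dense F ->
  exists q z', [/\ (r <= q)%N, agree p r z' z & blocks F p q z'].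
Proof.
move=> pr nF.
pose glue (w : {ffun 'I_p -> bool}) (z : cantor_space) : cantor_space :=
  fun i => if insub i is Some j then w j else z i.
have glueE w u i : (p <= i)%N -> glue w u i = u i.
  by move=> pi; rewrite /glue insubF// ltnNge pi.
have H : forall s : seq {ffun 'I_p -> bool}, exists q z',
    [/\ (r <= q)%N, agree p r z' z &
      forall y, agree p q y z' ->
        forall w, w \in s -> cylinder (glue w y) p y -> ~ F y].
  elim=> [|w s [q [z' [rq zz' Hs]]]]; first by exists r, z; split.
  (* The block is prolonged past [q] without changing it on [p, q[, so the segments in [s] stay
     handled; any [y] that starts with [w] and agrees with [x'] on [p, q'[ lies in the cylinder that
     misses [F]. *)
  have [q' [x' [qq' gx' nx']]] := nowhere_dense_cylinder (glue w z') q nF.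
  exists q', x'; split; first exact: leq_trans qq'.
    move=> i /andP[pi ir]; rewrite gx' ?(leq_trans ir)// glueE//.
    by apply: zz'; rewrite pi.
  move=> y yx' v; rewrite in_cons => /predU1P[->|vs] yv.
    apply: nx' => i iq'; have [pi|ip] := leqP p i.
      by apply: yx'; rewrite pi.
    rewrite yv// gx' ?(leq_trans ip)// ?(leq_trans pr)//.
    by rewrite /glue insubT.
  apply: Hs vs yv => i /andP[pi iq].
  by rewrite yx' ?pi ?(leq_trans iq)// gx' ?glueE.
have [q [z' [rq zz' Hz']]] := H (enum {ffun 'I_p -> bool}).
exists q, z'; split=> // y yz'.
apply: (Hz' y yz' [ffun i : 'I_p => y i]); first by rewrite mem_enum.
by move=> i ip; rewrite /glue insubT ffunE.
Qed.

(** Prolonging a block preserves the sets it already avoids, so [F 0], ..., [F n] are treated in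
    turn. The first prolongation starts from [p.+1], which makes the block nonempty. *)
Lemma nowhere_dense_seq_block (F : nat -> set cantor_space) n p :
  (forall n, nowhere_dense (F n)) ->
  exists q z, (p < q)%N /\ forall i, (i <= n)%N -> blocks (F i) p q z.
Proof.
move=> nF; elim: n => [|n [q [z [pq Hz]]]].
  have [q [z [pq _ Hz]]] :=
    nowhere_dense_block (fun=> false) (leqnSn p) (nF 0%N).
  by exists q, z; split=> // i; rewrite leqn0 => /eqP->.
have [q' [z' [qq' zz' Hz']]] := nowhere_dense_block z (ltnW pq) (nF n.+1).
exists q', z'; split=> [|i]; first exact: leq_trans qq'.
rewrite leq_eqVlt => /predU1P[->//|/Hz Fi] y yz'; apply: Fi => j /andP[pj jq].
by rewrite yz' ?zz' ?pj// (leq_trans jq).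
Qed.

(** The index of [k] is the least [n] with k < p n.+1; since p 0 = 0, no [k] lies below the first
    block. *)
Lemma block_index (p : nat -> nat) :
  p 0%N = 0%N -> (forall n, (p n < p n.+1)%N) ->
  exists phi : nat -> nat, forall k n, (phi k = n) <-> (p n <= k < p n.+1)%N.
Proof.
move=> p0 pS.
have pW m n : (m <= n)%N -> (p m <= p n)%N.
  by move=> /subnK <-; elim: (n - m)%N => // k /leq_trans; apply; exact/ltnW/pS.
have big i : exists n, (i < p n.+1)%N.
  exists i; elim: i => [|i IHi]; first exact: leq_ltn_trans (pS 0%N).
  exact: leq_ltn_trans IHi (pS _).
exists (fun k => ex_minn (big k)) => k n; case: ex_minnP => m km min_m; split.
  move=> <-; rewrite km andbT leqNgt; apply/negP; case: m {km} min_m => [|m].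
    by rewrite p0.
  by move=> /[apply]; rewrite ltnn.
move=> /andP[nk kn]; apply/eqP; rewrite eqn_leq min_m//= leqNgt.
by apply/negP => /pW; rewrite leqNgt (leq_ltn_trans nk).
Qed.

(** Blocks are concatenated, the [n]-th one avoiding [F 0], ..., [F n]. A point that follows [z] on
    infinitely many blocks does so, for every [i], on one of index at least [i], and therefore
    avoids [F i]. *)
Lemma meager_blocks (M : set cantor_space) : meager M ->
  exists (p : nat -> nat) (z : cantor_space),
    [/\ p 0%N = 0%N, forall n, (p n < p n.+1)%N &
      forall y, (forall m, exists2 n, (m <= n)%N & agree (p n) (p n.+1) y z) ->
        ~ M y].
Proof.
move=> [F nF ->].
have /choice[b bP] : forall np : nat * nat, exists qz : nat * cantor_space,
    (np.2 < qz.1)%N /\ forall i, (i <= np.1)%N -> blocks (F i) np.2 qz.1 qz.2.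
  move=> [n p]; have [q [z H]] := nowhere_dense_seq_block n p nF.
  by exists (q, z).
pose p := fix p n := if n is n'.+1 then (b (n', p n')).1 else 0%N.
have pS n : (p n < p n.+1)%N by case: (bP (n, p n)).
have [phi phiP] := block_index (erefl _ : p 0%N = 0%N) pS.
pose z : cantor_space := fun i => (b (phi i, p (phi i))).2 i.
exists p, z; split=> // y yz [i _ Fiy].
have [n le_in yzn] := yz i.
have [_ /(_ i le_in)/(_ y)] := bP (n, p n); apply=> // j /= jn.
by rewrite yzn// /z (phiP j n).2.
Qed.

(** * Ideals with the Baire property *)

Lemma ideal_initial_segment (I : set (set nat)) (n : nat) :
  is_ideal I -> I [set k | (k < n)%N].
Proof.
move=> [IU IS _ I1]; elim: n => [|n IHn]; first by apply: IS (I1 0%N) => k.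
apply: (IS _ _ _ (IU _ _ IHn (I1 n))) => k /=.
by rewrite ltnS leq_eqVlt => /predU1P[->|]; [right|left].
Qed.

(* Talagrand and Jalali-Naini: an ideal with the Baire property lies
   Rudin-Blass above the ideal of finite sets. *)
Lemma ideal_baire_finite_to_one (I : set (set nat)) :
  is_ideal I -> ideal_baire I ->
  exists phi : nat -> nat,
    (forall n, exists m, forall k, (m <= k)%N -> (n <= phi k)%N) /\
    forall B : set nat, (forall m, exists2 n, (m <= n)%N & B n) ->
      ~ I (phi @^-1` B).
Proof.
move=> idI [U oU /meager_blocks[p [z [p0 pS pz]]]].
have [IU IS IT _] := idI.
have [phi phiP] := block_index p0 pS.
have p_ge n : (n <= p n)%N by elim: n => // n /leq_ltn_trans; apply.
have phi_ge n k : (p n <= k)%N -> (n <= phi k)%N.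
  move=> pnk; rewrite leqNgt; apply/negP => kn.
  have /(_ erefl)/andP[_] := (phiP k (phi k)).1.
  rewrite ltnNge => /negP; apply; apply: leq_trans pnk.
  move: kn => /subnK <-; elim: (n - _)%N => // j /leq_trans; apply.
  exact/ltnW/pS.
(* The open set [U] is empty, so the ideal itself is meager: otherwise a cylinder inside [U] would
   contain the characteristic functions of two members of [I] with cofinite union. *)
have U0 x : ~ U x.
  move=> Ux; have /nbhs_has_cylinder[r rU] : nbhs x U by exact: open_nbhs_nbhs.
  (* [y false] and [y true] are complementary beyond [r] and both follow [z] on
     infinitely many blocks *)
  pose y (c : bool) : cantor_space :=
    fun i => if (i < r)%N then x i else z i (+) (odd (phi i) (+) c).
  have Iy c : exists2 A, I A & char_fun A = y c.
    have Uy : U (y c) by apply: rU => i; rewrite /y => ->.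
    apply: contrapT => nIy; apply: (pz (y c)); last by right.
    (* Beyond [r], [y c] copies [z] on the blocks whose index has parity [c]; an index at least [r]
       puts the block beyond [r], because n <= p n. *)
    have le_n m : (maxn m r <= (maxn m r).*2 + c)%N.
      by rewrite -addnn -addnA leq_addr.
    move=> m; exists ((maxn m r).*2 + c)%N.
      exact: leq_trans (leq_maxl _ _) (le_n m).
    move=> i in_i; have /andP[ni _] := in_i.
    rewrite /y ltnNge (leq_trans (leq_maxr m r) (leq_trans (le_n m) _))/=.
      by rewrite ((phiP _ _).2 in_i) oddD odd_double oddb addbb addbF.
    exact: leq_trans (p_ge _) ni.
  have [A IA Ay] := Iy false; have [B IB By] := Iy true.
  have IABr := IU _ _ (IU _ _ IA IB) (ideal_initial_segment r idI).
  apply: IT; apply: IS IABr.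
  move=> k _ /=; have [kr|rk] := ltnP k r; [by right|left].
  have := congr1 (@^~ k) Ay; have := congr1 (@^~ k) By.
  rewrite /char_fun /y ltnNge rk /= addbF addbT.
  case: asboolP => [Bk|_]; first by right.
  by case: asboolP => [Ak|_]; [left|case: (z k); case: odd].
exists phi; split=> [n|B infB IB]; first by exists (p n) => k /phi_ge.
(* This set coincides with [z] on the infinitely many blocks with index in [B], so its
   characteristic function escapes the meager set, although it comes from [I] and is not in [U]. *)
have IA : I [set k | z k /\ B (phi k)] by apply: IS IB => k [].
apply: (pz (char_fun [set k | z k /\ B (phi k)])).
  move=> m; have [n mn Bn] := infB m; exists n => // i /phiP pin.
  by rewrite /char_fun; apply/asboolP/idP => [[]//|zi]; split; rewrite //= pin.
by left; split; [exists [set k | z k /\ B (phi k)]|exact: U0].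
Qed.

(** * Dyadic grids in [-1, 1[ and the spreading of an ideal over them *)

Lemma dyadic_approximation (R : realType) (n : nat) (s : R) : `|s| <= 1 ->
  exists m, [/\ (2 ^ n <= m)%N, (m < 2 ^ n.+1)%N &
    `|2 * m%:R / 2 ^+ n - 3 - s| <= 2 / 2 ^+ n].
Proof.
rewrite ler_norml => /andP[s_ge s_le].
have n0 : (0 : R) < 2 ^+ n by rewrite exprn_gt0.
(* [x] is [s] pulled back along the map x |-> 2 x - 3 from [1, 2] onto [-1, 1]; in general [m] is
   the floor of 2 ^ n x. *)
pose x : R := (s + 3) / 2.
suff [m [nm mn mx xm]] : exists m, [/\ (2 ^ n <= m)%N, (m < 2 ^ n.+1)%N,
    m%:R <= 2 ^+ n * x & 2 ^+ n * x <= m%:R + 1].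
  exists m; split=> //.
  have -> : 2 * m%:R / 2 ^+ n - 3 - s = - (2 * (2 ^+ n * x - m%:R) / 2 ^+ n).
    by rewrite /x; field; rewrite gt_eqF.
  rewrite normrN ger0_norm ?divr_ge0 ?mulr_ge0 ?subr_ge0 ?(ltW n0)//.
  by rewrite ler_pM2r ?invr_gt0//; lra.
(* At s = 1 the floor would be 2 ^ n.+1, just out of range, so the last grid point is taken; its
   error is exactly the mesh 2 / 2 ^ n. *)
have [s1|s1] := eqVneq s 1.
  exists (2 ^ n.+1 - 1)%N; rewrite natrB ?expn_gt0// natrX exprS.
  have -> : x = 2 by rewrite /x s1; field.
  split; [|by rewrite subn1 ltn_predL expn_gt0|lra|lra].
  have : (0 < 2 ^ n)%N by rewrite expn_gt0.
  by rewrite expnS; lia.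
have x1 : 1 <= x < 2.
  have s1' : s < 1 by rewrite lt_neqAle s1.
  by rewrite /x; lra.
have /andP[x_ge x_lt] := x1.
have x0 : 0 <= 2 ^+ n * x by rewrite mulr_ge0 ?(ltW n0)//; lra.
have /andP[mx xm] := truncn_itv x0.
exists (Num.truncn (2 ^+ n * x)); split=> //.
- by rewrite truncn_ge_nat// natrX ler_peMr ?(ltW n0).
- by rewrite truncn_lt_nat// natrX exprSr ltr_pM2l.
- by rewrite natr1 ltW.
Qed.

(** The set in the last clause is a preimage under [phi], namely of the [m] such that m + 1 has
    binary level in [B] and grid value within [e] of [s]. Every fine enough level in [B] contributes
    such an [m], so there are infinitely many. *)
Lemma ideal_baire_spread (R : realType) (I : set (set nat)) :
  is_ideal I -> ideal_baire I ->
  exists (g : nat -> nat) (t : nat -> R),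
    [/\ forall n, exists m, forall k, (m <= k)%N -> (n <= g k)%N,
        forall k, `|t k| <= 1 &
        forall (B : set nat) (s e : R),
          (forall m, exists2 n, (m <= n)%N & B n) -> `|s| <= 1 -> 0 < e ->
          ~ I [set k | B (g k) /\ `|t k - s| < e] ].
Proof.
move=> idI bI; have [phi [phi_oo phiI]] := ideal_baire_finite_to_one idI bI.
pose u (m : nat) : R := 2 * m%:R / 2 ^+ trunc_log 2 m - 3.
exists (fun k => trunc_log 2 (phi k).+1), (fun k => u (phi k).+1); split.
- move=> n; have [m mP] := phi_oo (2 ^ n)%N; exists m => k /mP nk.
  by apply: trunc_log_max => //; exact: leqW.
- move=> k; rewrite /u; set m := (phi k).+1.
  have lm := @trunc_logP 2 m erefl erefl; have ml := @trunc_log_ltn 2 m erefl.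
  have n0 : (0 : R) < 2 ^+ trunc_log 2 m by rewrite exprn_gt0.
  rewrite ler_norml; apply/andP; split.
    rewrite lerBrDr ler_pdivlMr//.
    by move: lm; rewrite -(ler_nat R) natrX; lra.
  rewrite lerBlDr ler_pdivrMr//.
  by move: ml; rewrite -(ltr_nat R) natrX exprS; lra.
- move=> B s e infB s1 e0.
  pose C := [set m | B (trunc_log 2 m.+1) /\ `|u m.+1 - s| < e].
  apply: (phiI C) => j.
  (* The bound [j] on the level forces m >= j, and n > 2 / e makes the mesh 2 / 2 ^ n smaller than
     [e]. *)
  have [n jn Bn] := infB (maxn j (Num.truncn (2 / e)).+1).
  have [[|m] [nm mn ms]] := dyadic_approximation n s1.
    by move: nm; rewrite leqn0 expn_eq0.
  have lmn : trunc_log 2 m.+1 = n by apply: trunc_log_eq => //; rewrite nm.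
  exists m.
    rewrite -ltnS; apply: leq_trans nm.
    apply: leq_ltn_trans (ltn_expl n _) => //; apply: leq_trans jn.
    exact: leq_maxl.
  split; rewrite ?/u lmn//; apply: le_lt_trans ms _.
  rewrite ltr_pdivrMr ?exprn_gt0// mulrC -ltr_pdivrMr//.
  apply: lt_trans (truncnS_gt _) _; rewrite -natrX ltr_nat.
  apply: leq_ltn_trans (ltn_expl n _) => //; apply: leq_trans jn.
  exact: leq_maxr.
Qed.

(** * Ultrafilters on the natural numbers and the maps [pi] and [tau] *)

Lemma ultra_fmap (T T' : Type) (g : T -> T') (U : set_system T) :
  UltraFilter U -> UltraFilter (g @ U).
Proof.
move=> UU; split=> [|G PG UG]; first exact: fmap_proper_filter.
apply/seteqP; split=> // A GA.
have [//|UnA] := in_ultra_setVsetC (g @^-1` A) UU.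
have : G set0 by rewrite -(setICr A); apply: filterI => //; exact: UG.
by move/filter_not_empty.
Qed.

Lemma ultra_infinite (U : set_system nat) (A : set nat) m :
  UltraFilter U -> (forall n, U <> principal_filter n) -> U A ->
  exists2 n, (m <= n)%N & A n.
Proof.
move=> UU nU UA; suff Um : U [set k | (m <= k)%N].
  by have [n [An mn]] := @filter_ex _ U _ _ (filterI UA Um); exists n.
have UC1 n : U (~` [set n]).
  have [Un|//] := in_ultra_setVsetC [set n] UU.
  case: (nU n); apply: (@max_filter _ _ (principal_filter_ultra n)) => B.
  by move=> /principal_filterP Bn; apply: filterS Un => _ ->.
elim: m => [|m IHm]; first by apply: (filterS _ filterT) => k.
apply: (filterS _ (filterI IHm (UC1 m))) => k [/= mk km].
by rewrite ltn_neqAle mk andbT; apply/eqP => mk'; apply: km.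
Qed.

Lemma Nstar_ext (v w : Nstar) :
  sval (set_val v) = sval (set_val w) -> v = w.
Proof.
move=> vw; apply: val_inj; move: vw.
rewrite -[set_val v]/(val v) -[set_val w]/(val w).
by case: (val v) (val w) => [V UV] [W UW] /= VW; exact: eq_exist.
Qed.

Definition P_ultra (I : set (set nat)) (x : P_ideal I) : set_system nat :=
  sval (set_val (set_val x)).

#[local] Instance P_ultra_ultra (I : set (set nat)) (x : P_ideal I) :
  UltraFilter (P_ultra x).
Proof. exact: (svalP (set_val (set_val x))). Qed.

Lemma P_ultra_dual (I : set (set nat)) (x : P_ideal I) A :
  I A -> P_ultra x (~` A).
Proof. by move=> IA; apply: (set_valP x); exists A. Qed.

Lemma nbhs_P_ultra (I : set (set nat)) (x : P_ideal I) A :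
  P_ultra x A -> nbhs x [set y : P_ideal I | P_ultra y A].
Proof.
move=> xA.
have c : continuous (fun y : P_ideal I => set_val (set_val y) : betaN).
  by move=> y; apply: continuous_comp; exact: initial_continuous.
apply: (c x (stone_basic A)); apply: open_nbhs_nbhs.
by split; first exact: open_stone_basic.
Qed.

(** As [g] tends to infinity, the preimage of a singleton is bounded, hence in [I], so the image
    ultrafilter is non-principal. Continuity holds because basic open sets pull back to basic open
    sets. *)
Lemma P_ideal_push (I : set (set nat)) (g : nat -> nat) :
  is_ideal I ->
  (forall n, exists m, forall k, (m <= k)%N -> (n <= g k)%N) ->
  exists2 pi : P_ideal I -> Nstar, continuous pi &
    forall x, sval (set_val (pi x)) = g @ P_ultra x.
Proof.
move=> idealI g_oo.
have /choice[pi piE] : forall x : P_ideal I,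
    exists v : Nstar, sval (set_val v) = g @ P_ultra x.
  move=> x; pose w : betaN := exist _ _ (ultra_fmap g (P_ultra_ultra x)).
  suff wr : remainder w by exists (SigSub (mem_set wr)).
  move=> n wn; have xn : P_ultra x (g @^-1` [set n]).
    suff : principal_filter n [set n] by rewrite -wn.
    exact/principal_filterP.
  have [m gm] := g_oo n.+1.
  have [k [/= kn km]] := @filter_ex _ (P_ultra x) _ _
    (filterI xn (P_ultra_dual x (ideal_initial_segment m idealI))).
  by move/negP: km; rewrite -leqNgt => /gm; rewrite kn ltnn.
exists pi => //; apply: continuous_comp_initial => x W.
rewrite nbhsE => -[Y [[D _ <-] [A DA xA]] YW].
have xgA : P_ultra x (g @^-1` A).
  by suff : sval (set_val (pi x)) A by rewrite piE.
have := nbhs_P_ultra xgA; apply: filterS => y yA; apply: YW; exists A => //.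
suff : sval (set_val (pi y)) A by [].
by rewrite piE.
Qed.

(** Limits along ultrafilters exist by compactness of [-1, 1]. For continuity, the set of [k] with
    [t k] within e / 2 of [tau x] defines a neighbourhood of [x]; for [y] in it, some such [k] also
    has [t k] within e / 2 of [tau y]. *)
Lemma P_ideal_lim (R : realType) (I : set (set nat)) (t : nat -> R) :
  (forall k, `|t k| <= 1) ->
  exists tau : P_ideal I -> R,
    [/\ continuous tau, forall x, `|tau x| <= 1 &
      forall x, t @ P_ultra x --> tau x].
Proof.
move=> t_le1.
have /choice[tau tauP] : forall x : P_ideal I, exists s,
    `|s| <= 1 /\ t @ P_ultra x --> s.
  move=> x; have := @segment_compact R (-1) 1; rewrite compact_ultra.
  have t1 : P_ultra x (t @^-1` `[-1, 1]).
    apply: (filterS _ filterT) => k _ /=; rewrite in_itv/= -ler_norml.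
    exact: t_le1.
  move=> /(_ _ (ultra_fmap t (P_ultra_ultra x)) t1)[s [/= s1 ts]].
  by exists s; split=> //; rewrite ler_norml; move: s1; rewrite in_itv.
exists tau; split=> [x|x|x]; [|by case: (tauP x)..].
have Fx : Filter (nbhs x) := nbhs_filter x.
apply/cvgrPdist_le => e e0.
have [_ /cvgrPdist_lt tx] := tauP x.
have xe := tx _ (divr_gt0 e0 (ltr0Sn _ 1)).
apply: filterS (nbhs_P_ultra xe) => y /= ye.
have [_ /cvgrPdist_lt ty] := tauP y.
have ye' := ty _ (divr_gt0 e0 (ltr0Sn _ 1)).
have [k [/= k1 k2]] := @filter_ex _ (P_ultra y) _ _ (filterI ye ye').
rewrite -(subrKA (t k)) (splitr e) (le_trans (ler_normD _ _))// lerD ?ltW//.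
by rewrite distrC.
Qed.

(** The required point is an ultrafilter extending the filter generated by the dual filter of [I],
    the preimages under [g] of the members of [v], and the preimages under [t] of the neighbourhoods
    of [s]. *)
Lemma P_ideal_joint_surjective (R : realType) (I : set (set nat))
    (g : nat -> nat) (t : nat -> R)
    (pi : P_ideal I -> Nstar) (tau : P_ideal I -> R) :
  is_ideal I ->
  (forall x, sval (set_val (pi x)) = g @ P_ultra x) ->
  (forall x, t @ P_ultra x --> tau x) ->
  (forall (B : set nat) (s e : R),
    (forall m, exists2 n, (m <= n)%N & B n) -> `|s| <= 1 -> 0 < e ->
    ~ I [set k | B (g k) /\ `|t k - s| < e]) ->
  forall v s, `|s| <= 1 -> exists x, pi x = v /\ tau x = s.
Proof.
move=> idealI piE tauE spread v s s1.
have [IU IS IT I1] := idealI.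
pose V : set_system nat := sval (set_val v).
have UV : UltraFilter V by exact: svalP.
have nV n : V <> principal_filter n by exact: (set_valP v).
pose S (ABe : set nat * set nat * R) : set nat :=
  [set k | [/\ ABe.1.1 (g k), ~ ABe.1.2 k & `|t k - s| < ABe.2]].
pose D : set (set nat * set nat * R) :=
  [set ABe | [/\ V ABe.1.1, I ABe.1.2 & 0 < ABe.2]].
have I0 : I set0 by apply: IS (I1 0%N).
pose F := filter_from D S.
have PF : ProperFilter F.
  apply: filter_from_proper.
    apply: filter_from_filter.
      by exists (setT, set0, 1); split => //=; exact: filterT.
    move=> [[A B] e] [[A' B'] e'] [/= VA IB e0] [/= VA' IB' e'0].
    exists (A `&` A', B `|` B', Num.min e e').
      by split=> /=; [exact: filterI|exact: IU|rewrite lt_min e0].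
    move=> k [/= [Ak A'k] /not_orP[Bk B'k]].
    by rewrite lt_min => /andP[ke ke']; split; split.
  (* Were [S] empty here, the set that [spread] keeps out of [I] would be contained in [B]; [A] is
     infinite because [v] is non-principal. *)
  move=> [[A B] e] [/= VA IB e0]; apply: contrapT => S0.
  apply: (spread A s e) => //; first by move=> m; exact: ultra_infinite VA.
  apply: IS IB => k [Ak ke]; apply: contrapT => Bk.
  by apply: S0; exists k; split.
have [U [UU FU]] := ultraFilterLemma PF.
have UI A : I A -> U (~` A).
  move=> IA; apply: FU; exists (setT, A, 1); last by move=> k [].
  by split => //=; exact: filterT.
have rU : remainder (exist _ U UU).
  move=> n /= Un; have := UI _ (I1 n); rewrite Un => /principal_filterP.
  exact.
have PU : P_ideal_set I (SigSub (mem_set rU)) by move=> _ [A IA <-]; exact: UI.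
pose x : P_ideal I := SigSub (mem_set PU).
exists x; split.
  suff E : sval (set_val (pi x)) = V.
    exact: Nstar_ext.
  (* By maximality of [V], it suffices that the image of [U] under [g] contains [V]. *)
  rewrite piE; apply: (@max_filter _ _ UV) => A VA.
  apply: FU; exists (A, set0, 1); [by split | by move=> k []].
have PUx : ProperFilter (t @ U) by exact: fmap_proper_filter.
apply: (@cvg_unique _ _ (t @ U)); first exact: norm_hausdorff.
  exact: tauE.
apply/cvgrPdist_lt => e e0; apply: FU; exists (setT, set0, e).
  by split=> //=; exact: filterT.
by move=> k [_ _ /=]; rewrite distrC.
Qed.

(** * The linear isometry and the range of its values *)

Lemma isometric_scaled_composition (R : realType) (K L : compactSpaceType)
    (pi : K -> L) (tau : K -> R) :
  continuous pi -> continuous tau -> (forall x, `|tau x| <= 1) ->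
  (forall v s, `|s| <= 1 -> exists x, pi x = v /\ tau x = s) ->
  exists V : set (Cspace R K),
    [/\ linear_subspace V,
        V `<=` [set f | proper_interval (rng f)] `|` [set 0] &
        isometric_to (Cspace R L) V].
Proof.
move=> cpi ctau tau1 surj.
have cT (f : Cspace R L) : continuous (fun x => tau x * Cspace_fun f (pi x)).
  move=> x; apply: cvgM; first exact: ctau.
  by apply: continuous_comp; [exact: cpi|exact: Cspace_continuous].
pose T f : Cspace R K := mkcts (cT f).
have TE f x : Cspace_fun (T f) x = tau x * Cspace_fun f (pi x) by [].
have Tlin : linear T.
  move=> a f h; apply: Cspace_ext => x.
  rewrite -[LHS]/(tau x * (a * Cspace_fun f (pi x) + Cspace_fun h (pi x))).
  by rewrite mulrDr mulrCA.
pose TL : {linear Cspace R L -> Cspace R K} :=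
  HB.pack T (GRing.isLinear.Build _ _ _ _ T Tlin).
have normT f : `|TL f| = `|f|.
  apply/eqP; rewrite eq_le; apply/andP; split; apply: sup_norm_le.
  - exact: sup_norm_ge0.
  - move=> x; rewrite [leLHS]normrM; apply: (le_trans _ (sup_norm_ub f (pi x))).
    by rewrite ler_piMl.
  - exact: sup_norm_ge0.
  (* The lower bound on the norm uses a point above [v] at which [tau] is 1, so that [T f] takes
     there the value of [f] at [v]. *)
  - move=> v; have [|x [<- taux]] := surj v 1; first by rewrite normr1.
    have := sup_norm_ub (T f) x.
    by rewrite TE taux mul1r.
exists (range TL); split.
- split; first by exists 0 => //; rewrite linear0.
  by move=> a _ _ [f _ <-] [h _ <-]; exists (a *: f + h) => //; rewrite linearP.
- move=> _ [f _ <-].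
  have [->|f0] := eqVneq f 0; first by right; rewrite linear0.
  left.
  have [v fv] : exists v, Cspace_fun f v != 0.
    apply: contrapT => /forallNP f00; case/eqP: f0; apply: Cspace_ext => v.
    by apply/eqP; apply: contrapT => /negP /f00.
  have cnf : {within [set: L], continuous (fun v => `|Cspace_fun f v|)}.
    apply: continuous_subspaceT => w.
    by apply: cvg_norm; exact: Cspace_continuous.
  have L0 : [set: L] !=set0 by exists v.
  (* The maximum of |f| is attained at [w], which makes the range closed: each [y] with |y| <= |M|
     is the value at a point above [w] where [tau] equals y / M. *)
  have [w _ maxw] := compact_EVT_max L0 compactT cnf.
  pose M := Cspace_fun f w.
  have M0 : 0 < `|M| by rewrite (lt_le_trans _ (maxw v _)) ?normr_gt0 ?inE.
  have rngT y : rng (TL f) y <-> `|y| <= `|M|.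
    split=> [[x _ <-]|yM].
      rewrite [leLHS]normrM.
      apply: le_trans (maxw (pi x) _); last by rewrite inE.
      by rewrite ler_piMl.
    have [|x [pix taux]] := surj w (y / M).
      by rewrite normrM normfV ler_pdivrMr ?mul1r.
    exists x => //; rewrite TE taux pix divfK//.
    by rewrite -normr_gt0.
  split.
    move=> a b /rngT aM /rngT bM c /andP[ac cb]; apply/rngT.
    by move: aM bM; rewrite !ler_norml => /andP[a1 _] /andP[_ b1];
      rewrite (le_trans a1)//= (le_trans cb).
  exists (- `|M|), `|M|; split; [apply/rngT|apply/rngT|].
  - by rewrite normrN normr_id.
  - by rewrite normr_id.
  - by rewrite gtrN.
- by exists TL.
Qed.

Theorem theorem15 (R : realType) (I : set (set nat))
    (idealI : is_ideal I) (baireI : ideal_baire I) :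
  exists V : set (Cspace R (P_ideal I)),
    [/\ linear_subspace V,
        V `<=` [set f | proper_interval (rng f)] `|` [set 0] &
        isometric_to (Cspace R Nstar) V].
Proof.
have [g [t [g_oo t_le1 spread]]] := ideal_baire_spread R idealI baireI.
have [pi cpi piE] := P_ideal_push idealI g_oo.
have [tau [ctau tau_le1 tauE]] := P_ideal_lim I t_le1.
apply: (isometric_scaled_composition cpi ctau tau_le1).
exact: P_ideal_joint_surjective piE tauE spread.
Qed.
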